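(* Let $K$ be a field, $G$ a group, $H$ a normal subgroup of $G$, and $\rho$ an irreducible (possibly infinite-dimensional) representation of $H$ over $K$. Suppose that the natural homomorphism $\operatorname{End}_H(\rho)\to\operatorname{End}_G\big(\operatorname{ind}_H^G(\rho)\big)$ is an isomorphism. Then the representation $\operatorname{ind}_H^G(\rho)$ of $G$ is irreducible.
   Context: Finitely induced representation: for a subgroup $H\subset G$ and a representation $\rho$ of $H$ on a $K$-vector space $V$, $\operatorname{ind}_H^G(\rho)$ is the space of all functions $f\colon G\to V$ such that $f(hg)=\rho(h)f(g)$ for all $h\in H$, $g\in G$, and such that the support of $f$ is a union of finitely many right cosets $Hg$; $G$ acts by right translations, $(g_0f)(x)=f(xg_0)$. The natural homomorphism $\operatorname{End}_H(\rho)\to\operatorname{End}_G(\operatorname{ind}_H^G(\rho))$ is given by functoriality of $\operatorname{ind}_H^G$: it sends $\varphi$ to the endomorphism $f\mapsto\varphi\circ f$. *)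

(* Defs.v *)
From HB Require Import structures.
From mathcomp Require Import all_boot all_order all_algebra.
From mathcomp Require Import boolp classical_sets functions cardinality.

Set Implicit Arguments.
Unset Strict Implicit.
Unset Printing Implicit Defensive.

Import GRing.Theory.
Local Open Scope classical_set_scope.
Local Open Scope ring_scope.

Record representation (K : fieldType) (G : groupType) (V : lmodType K) :=
  Representation {
    rep_fun :> G -> {linear V -> V};
    rep1 : forall v, rep_fun 1%g v = v;
    repM : forall g h v, rep_fun (g * h)%g v = rep_fun g (rep_fun h v)
  }.

Definition irreducible (K : fieldType) (G : groupType) (V : lmodType K)
    (rho : representation G V) : Prop :=
  (exists v : V, v != 0) /\
  forall W : {pred V}, submod_closed W ->
    (forall g, {in W, forall v, rho g v \in W}) ->
    W =i pred1 0 \/ W =i predT.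

(* The library only provides normality for subgroups of finite groups. *)
Definition normal_subgroup (G : groupType) (S : {pred G}) : Prop :=
  {in S, forall h (g : G), (h ^ g)%g \in S}.

Section Endomorphisms.
Context {K : fieldType} {G : groupType} {V : lmodType K}.
Variable rho : representation G V.

Definition intertwining : {pred V -> V} :=
  fun phi => `[< linear phi /\ forall g v, phi (rho g v) = rho g (phi v) >].

Lemma intertwiningP phi :
  reflect (linear phi /\ forall g v, phi (rho g v) = rho g (phi v))
          (phi \in intertwining).
Proof. exact: asboolP. Qed.

Lemma intertwining_submod_closed : submod_closed intertwining.
Proof.
split=> [|a p q /intertwiningP[pL pG] /intertwiningP[qL qG]]; apply/intertwiningP.
  split=> [b u v|g v].
    by rewrite -[LHS]/(0 : V) -[RHS]/(b *: (0 : V) + 0) scaler0 addr0.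
  by rewrite -[LHS]/(0 : V) -[RHS]/(rho g (0 : V)) linear0.
split=> [b u v|g v].
  rewrite /= -[LHS]/(a *: p (b *: u + v) + q (b *: u + v)) pL qL.
  rewrite -[RHS]/(b *: (a *: p u + q u) + (a *: p v + q v)).
  by rewrite !scalerDr !scalerA (mulrC a b) addrACA.
rewrite -[LHS]/(a *: p (rho g v) + q (rho g v)) pG qG.
by rewrite -[(a *: p + q) v]/(a *: p v + q v) linearP.
Qed.

(* End_G(rho) *)
Record endo := Endo { endo_fun :> V -> V; _ : endo_fun \in intertwining }.

HB.instance Definition _ := [isSub for endo_fun].
HB.instance Definition _ := [Choice of endo by <:].
HB.instance Definition _ :=
  GRing.SubChoice_isSubLmodule.Build K _ intertwining endo
    intertwining_submod_closed.

Lemma endoP (phi psi : endo) : phi =1 psi -> phi = psi.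
Proof. by move=> e; apply/val_inj/funext. Qed.

Lemma endo_linear (phi : endo) : linear phi.
Proof. by have /intertwiningP[] := valP phi. Qed.

Lemma endo_commute (phi : endo) g v : phi (rho g v) = rho g (phi v).
Proof. by have /intertwiningP[_] := valP phi. Qed.

HB.instance Definition _ (phi : endo) :=
  GRing.isLinear.Build K V V *:%R phi (endo_linear phi).

Lemma endo_one_subproof : idfun \in intertwining.
Proof. by apply/intertwiningP. Qed.
Definition endo_one : endo := Endo endo_one_subproof.

Lemma endo_mul_subproof (phi psi : endo) : phi \o psi \in intertwining.
Proof.
by apply/intertwiningP; split=> [a u v|g v] /=; rewrite ?linearP ?endo_commute.
Qed.
Definition endo_mul (phi psi : endo) : endo := Endo (endo_mul_subproof phi psi).

Lemma endo_mulA : associative endo_mul.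
Proof. by move=> p q r; apply: endoP. Qed.
Lemma endo_mul1r : left_id endo_one endo_mul.
Proof. by move=> p; apply: endoP. Qed.
Lemma endo_mulr1 : right_id endo_one endo_mul.
Proof. by move=> p; apply: endoP. Qed.
Lemma endo_mulDl : left_distributive endo_mul +%R.
Proof. by move=> p q r; apply: endoP. Qed.
Lemma endo_mulDr : right_distributive endo_mul +%R.
Proof. by move=> p q r; apply: endoP => v /=; rewrite linearD. Qed.

HB.instance Definition _ := GRing.Zmodule_isPzRing.Build endo
  endo_mulA endo_mul1r endo_mulr1 endo_mulDl endo_mulDr.

End Endomorphisms.

Section FinitelyInduced.
Context {K : fieldType} {G : groupType} {S : {pred G}} {H : subGroupType S}.
Context {V : lmodType K}.
Variable rho : representation H V.

Definition right_coset (g : G) : set G := range (fun h : H => (val h * g)%g).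

Definition ind_fun : {pred G -> V} := fun f =>
  `[< (forall (h : H) (g : G), f (val h * g)%g = rho h (f g)) /\
      exists2 A : set G, finite_set A &
        [set x | f x != 0] = \bigcup_(g in A) right_coset g >].

Lemma ind_funP f :
  reflect ((forall (h : H) (g : G), f (val h * g)%g = rho h (f g)) /\
           exists2 A : set G, finite_set A &
             [set x | f x != 0] = \bigcup_(g in A) right_coset g)
          (f \in ind_fun).
Proof. exact: asboolP. Qed.

Lemma right_coset_id g : right_coset g g.
Proof. by exists 1%g => //=; rewrite gmulf1 mul1g. Qed.

Lemma rep_eq0 (h : H) v : (rho h v == 0) = (v == 0).
Proof.
apply/eqP/eqP => [e|->]; last exact: linear0.
by rewrite -(rep1 rho v) -(mulVg h) repM e linear0.
Qed.

(* For an equivariant function the support is automatically a union of right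
   cosets, so only a finite cover is needed. *)
Lemma ind_fun_cover f (A : set G) :
    (forall (h : H) (g : G), f (val h * g)%g = rho h (f g)) ->
    finite_set A -> [set x | f x != 0] `<=` \bigcup_(g in A) right_coset g ->
  f \in ind_fun.
Proof.
move=> fH finA sub; apply/ind_funP; split=> //.
exists (A `&` [set x | f x != 0]); first exact: finite_setIl.
apply/seteqP; split=> [x /[dup] fx /sub [g Ag [h _ /= hg]]|x [g [_ /= fg] [h _ /= <-]]].
  exists g; last by exists h.
  by split=> //=; move: fx; rewrite /= -hg fH rep_eq0.
by rewrite fH rep_eq0.
Qed.

Lemma ind_submod_closed : submod_closed ind_fun.
Proof.
split=> [|a p q /ind_funP[pH [A finA pA]] /ind_funP[qH [B finB qB]]].
  by apply: (@ind_fun_cover _ set0) => [h g||x /=]; rewrite ?linear0 ?eqxx.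
apply: (@ind_fun_cover _ (A `|` B)).
- by move=> h g; rewrite -[LHS]/(a *: p _ + q _) pH qH -linearP.
- by rewrite finite_setU.
- rewrite bigcup_setU -pA -qB => x /=.
  rewrite -[(a *: p + q) x]/(a *: p x + q x).
  by have [->|] := eqVneq (p x) 0; [rewrite scaler0 add0r; right|left].
Qed.

(* The underlying space of ind_H^G(rho) *)
Record ind := Ind { ind_val :> G -> V; _ : ind_val \in ind_fun }.

HB.instance Definition _ := [isSub for ind_val].
HB.instance Definition _ := [Choice of ind by <:].
HB.instance Definition _ :=
  GRing.SubChoice_isSubLmodule.Build K _ ind_fun ind ind_submod_closed.

Lemma indP (f1 f2 : ind) : f1 =1 f2 -> f1 = f2.
Proof. by move=> e; apply/val_inj/funext. Qed.

Lemma ind_equivariant (f : ind) (h : H) g : f (val h * g)%g = rho h (f g).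
Proof. by have /ind_funP[] := valP f. Qed.

Lemma ind_act_subproof (g0 : G) (f : ind) :
  (fun x => f (x * g0)%g) \in ind_fun.
Proof.
have /ind_funP[fH [A finA fA]] := valP f.
apply: (@ind_fun_cover _ [set (g * g0^-1)%g | g in A]).
- by move=> h g; rewrite -mulgA fH.
- exact: finite_image.
- move=> x /= fx.
  have : [set x | val f x != 0] (x * g0)%g by [].
  rewrite fA => -[g Ag [h _ /= hg]].
  exists (g * g0^-1)%g; first by exists g.
  by exists h => //=; rewrite mulgA hg mulgK.
Qed.
Definition ind_act (g0 : G) (f : ind) : ind := Ind (ind_act_subproof g0 f).

Lemma ind_act_linear g0 : linear (ind_act g0).
Proof. by move=> a f1 f2; apply: indP. Qed.
HB.instance Definition _ g0 :=
  GRing.isLinear.Build K ind ind *:%R (ind_act g0) (ind_act_linear g0).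

Lemma ind_act1 f : ind_act 1%g f = f.
Proof. by apply: indP => x /=; rewrite mulg1. Qed.

Lemma ind_actM g h f : ind_act (g * h)%g f = ind_act g (ind_act h f).
Proof. by apply: indP => x /=; rewrite mulgA. Qed.

(* ind_H^G(rho) *)
Definition ind_rep : representation G ind :=
  @Representation K G ind (fun g => ind_act g) ind_act1 ind_actM.

Lemma ind_comp_subproof (phi : endo rho) (f : ind) : phi \o f \in ind_fun.
Proof.
have /ind_funP[fH [A finA fA]] := valP f.
apply: (@ind_fun_cover _ A) => [h g|//|].
  by rewrite /= ind_equivariant endo_commute.
rewrite -fA => x /=; apply: contra_neq => ->; exact: linear0.
Qed.
Definition ind_comp (phi : endo rho) (f : ind) : ind :=
  Ind (ind_comp_subproof phi f).

Lemma ind_endo_subproof (phi : endo rho) : ind_comp phi \in intertwining ind_rep.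
Proof.
apply/intertwiningP; split=> [a f1 f2|g f]; apply: indP => x //.
exact: (linearP phi).
Qed.

(* The natural homomorphism End_H(rho) -> End_G(ind_H^G(rho)) *)
Definition ind_endo (phi : endo rho) : endo ind_rep :=
  Endo (ind_endo_subproof phi).

Lemma ind_endo_linear : linear ind_endo.
Proof. by move=> a p q; apply: endoP => f; apply: indP. Qed.
HB.instance Definition _ :=
  GRing.isLinear.Build K (endo rho) (endo ind_rep) *:%R ind_endo ind_endo_linear.

Lemma ind_endo_monoid_morphism : monoid_morphism ind_endo.
Proof. by split=> [|p q]; apply: endoP => f; apply: indP. Qed.
HB.instance Definition _ :=
  GRing.isMonoidMorphism.Build (endo rho) (endo ind_rep) ind_endo
    ind_endo_monoid_morphism.

End FinitelyInduced.

Arguments ind_endo {K G S H V} rho phi.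

(* Main.v *)
(* By normality, evaluation at g intertwines the restriction of ind(rho) to H
   with the conjugate of rho by g.  In a nonzero subrepresentation W pick a
   nonzero function whose support meets the fewest right cosets; on the
   functions of W with support in these cosets, evaluation at each of their
   representatives is then injective, and it is onto by irreducibility of rho.
   Two distinct cosets H g0, H g1 in the support would give a nonzero theta
   carrying f g0 to f g1, hence an endomorphism f |-> theta (f (t^-1 * _)),
   t = g1 g0^-1, of ind(rho); as it moves the support it is not induced from
   End(rho).  So the support is a single coset, and W contains every function
   supported on one coset. *)
Require Import Defs.
From mathcomp Require Import all_boot all_order all_algebra.
From mathcomp Require Import boolp classical_sets functions cardinality.

Set Implicit Arguments.
Unset Strict Implicit.
Unset Printing Implicit Defensive.

Import GRing.Theory.
Local Open Scope classical_set_scope.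
Local Open Scope ring_scope.

Section Induced.
Context {K : fieldType} {G : groupType} {S : {pred G}} {H : subGroupType S}.
Context {V : lmodType K}.
Variable rho : representation H V.

(** * Covering supports by finite lists of right cosets *)

Local Notation coset g := (right_coset (H := H) g).

Lemma subgroup_valP (h : H) : val h \in S.
Proof. exact: (valP h). Qed.

Lemma subgroup_val_ex x : x \in S -> exists h : H, val h = x.
Proof. by move=> Sx; exists (Sub x Sx); rewrite SubK. Qed.

Definition covered (s : seq G) (f : ind rho) : Prop :=
  forall x, f x != 0 -> exists2 g, g \in s & coset g x.

Lemma right_coset_trans x y z : coset x y -> coset y z -> coset x z.
Proof.
by move=> [h _ <-] [k _ <-]; exists (k * h)%g; rewrite // gmulfM mulgA.
Qed.

Lemma ind_coset_eq0 (f : ind rho) g x : coset g x -> f g = 0 -> f x = 0.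
Proof. by move=> [h _ <-] f0; rewrite ind_equivariant f0 linear0. Qed.

Lemma coveredP (f : ind rho) : exists s, covered s f.
Proof.
have /ind_funP[_ [A /finite_seqP[s ->] sf]] := valP f; exists s => x fx.
have : [set y | val f y != 0] x by [].
by rewrite sf => -[g gs gx]; exists g.
Qed.

Lemma covered_comb s a (f1 f2 : ind rho) :
  covered s f1 -> covered s f2 -> covered s (a *: f1 + f2).
Proof.
move=> c1 c2 x; rewrite -[(a *: f1 + f2) x]/(a *: f1 x + f2 x).
have [->|/c1//] := eqVneq (f1 x) 0.
by rewrite scaler0 add0r; apply: c2.
Qed.

Lemma covered0 s : covered s (0 : ind rho).
Proof. by move=> x; rewrite -[(0 : ind rho) x]/(0 : V) eqxx. Qed.

Lemma covered_nil (f : ind rho) : covered [::] f -> f = 0.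
Proof.
by move=> c; apply: indP => x; apply/eqP; apply: contraT => /c[].
Qed.

Lemma covered_behead s g (f : ind rho) :
  covered (g :: s) f -> f g = 0 -> covered s f.
Proof.
move=> c f0 x fx; have [k] := c x fx.
rewrite inE => /orP[/eqP -> kx|ks kx]; last by exists k.
by move: fx; rewrite (ind_coset_eq0 kx f0) eqxx.
Qed.

Lemma covered_mem s1 s2 (f : ind rho) :
  s1 =i s2 -> covered s1 f -> covered s2 f.
Proof. by move=> e c x /c[g gs gx]; exists g; rewrite -?e. Qed.

Lemma covered_act s g0 (f : ind rho) :
  covered s f -> covered [seq (g * g0^-1)%g | g <- s] (ind_act g0 f).
Proof.
move=> c x /c[g gs [h _ hg]].
exists (g * g0^-1)%g; first by apply/mapP; exists g.
by exists h => //; rewrite mulgA hg mulgK.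
Qed.

(** By normality [x g0^-1 x^-1] lies in [S], so [x g0] and [x] share a right coset. *)
Lemma covered_act_normal s g0 (f : ind rho) :
  normal_subgroup S -> g0 \in S -> covered s f -> covered s (ind_act g0 f).
Proof.
move=> nS Sg0 c x /c[g gs gx]; exists g => //.
apply: (right_coset_trans gx).
have Sk : (g0^-1 ^ x^-1)%g \in S.
  by have [h <-] := subgroup_val_ex Sg0; rewrite nS // -gmulfV subgroup_valP.
have [k kE] := subgroup_val_ex Sk; exists k => //.
by rewrite kE /conjg invgK !mulgA !mulgVK.
Qed.

(** The copy of [rho] formed by the induced functions that vanish off [S]; they serve to test
    endomorphisms. *)
Definition delta_fun (v : V) : G -> V :=
  fun x => if insub x is Some h then rho h v else 0.

Lemma delta_fun_out v x : x \notin S -> delta_fun v x = 0.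
Proof. by move=> xS; rewrite /delta_fun insubN. Qed.

Lemma delta_fun_val v (h : H) : delta_fun v (val h) = rho h v.
Proof. by rewrite /delta_fun valK. Qed.

Lemma delta_subproof v : delta_fun v \in ind_fun rho.
Proof.
apply: (@ind_fun_cover _ _ _ _ _ _ _ [set 1%g]).
- move=> h g; have [gS|gS] := boolP (g \in S).
    by have [k <-] := subgroup_val_ex gS; rewrite -gmulfM !delta_fun_val repM.
  rewrite !delta_fun_out ?linear0 //; apply: contra gS => hgS.
  have [k kE] := subgroup_val_ex hgS.
  by rewrite -(mulKg (val h) g) -kE -gmulfV -gmulfM subgroup_valP.
- exact: finite_set1.
- move=> x /=; have [xS _|xS] := boolP (x \in S).
    have [h hE] := subgroup_val_ex xS.
    by exists 1%g => //; exists h => //; rewrite hE mulg1.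
  by rewrite delta_fun_out ?eqxx.
Qed.

Definition delta v : ind rho := Ind (delta_subproof v).

Lemma delta1 v : delta v 1%g = v.
Proof.
have <- : val (1%g : H) = 1%g by apply: gmulf1.
by rewrite /= delta_fun_val rep1.
Qed.

(** * Endomorphisms that translate supports *)

Section Translation.
Variables (theta : V -> V) (t : G).
Hypotheses (theta_lin : linear theta)
  (theta_rho : forall h k : H, val h = (val k ^ t)%g ->
     forall v, theta (rho h v) = rho k (theta v)).
Hypothesis nS : normal_subgroup S.

Let theta0 : theta 0 = 0.
Proof. by have := theta_lin (-1) 0 0; rewrite !scaleN1r !addNr. Qed.

(** Equivariance rests on [t^-1 k g = (k ^ t) t^-1 g], where [k ^ t] is in [S] by normality. *)
Lemma translation_subproof (f : ind rho) :
  (fun x => theta (f (t^-1 * x)%g)) \in ind_fun rho.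
Proof.
have [s sf] := coveredP f.
apply: (@ind_fun_cover _ _ _ _ _ _ _ [set` [seq (t * g)%g | g <- s]]).
- move=> k g; have Sk : (val k ^ t)%g \in S by rewrite nS ?subgroup_valP.
  have [h hE] := subgroup_val_ex Sk.
  rewrite -(theta_rho hE) -ind_equivariant hE.
  by rewrite /conjg !mulgA mulgK.
- exact: finite_seq.
- move=> x /= fx.
  have /sf[g gs [h _ hg]] : f (t^-1 * x)%g != 0.
    by apply: contra_neq fx => ->; exact: theta0.
  exists (t * g)%g; first by apply/mapP; exists g.
  have Sh : (val h ^ t^-1)%g \in S by rewrite nS ?subgroup_valP.
  have [k kE] := subgroup_val_ex Sh; exists k => //.
  by rewrite kE /conjg invgK !mulgA mulgVK -mulgA hg mulVKg.
Qed.

Definition translation (f : ind rho) : ind rho := Ind (translation_subproof f).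

Lemma translation_intertwining : translation \in intertwining (ind_rep rho).
Proof.
apply/intertwiningP; split=> [a f1 f2|g f]; apply: indP => x /=.
  exact: theta_lin.
by rewrite mulgA.
Qed.

(** Compare both endomorphisms on [delta v] at [t]: the induced one gives [psi 0 = 0] as [t] is
    outside [S], the translation gives [theta v]. *)
Lemma translation_induced_eq0 (psi : endo rho) :
  t \notin S -> ind_endo rho psi =1 translation -> theta =1 (fun=> 0).
Proof.
move=> tS e v; have /(congr1 (fun f : ind rho => f t)) := e (delta v).
by rewrite /= delta_fun_out // linear0 mulVg (delta1 v : delta_fun v 1%g = v).
Qed.

End Translation.

(** * Evaluation maps on a subrepresentation *)

Section Subrepresentation.
Variable W : {pred ind rho}.
Hypotheses (nS : normal_subgroup S) (irr : irreducible rho)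
  (submodW : submod_closed W)
  (actW : forall g, {in W, forall f, ind_rep rho g f \in W}).

Lemma eval_onto s g f : f \in W -> covered s f -> f g != 0 ->
  forall v, exists f', [/\ f' \in W, covered s f' & f' g = v].
Proof.
move=> fW cf fg.
(* These values at [g] form a nonzero subrepresentation of [rho]: right translation by [h ^ g] acts
   on them as [rho h]. *)
pose E : {pred V} :=
  fun v => `[< exists f', [/\ f' \in W, covered s f' & f' g = v] >].
have [W0 Wlin] := submodW.
have [_ /(_ E)] := irr; case.
- split=> [|a u v /asboolP[f1 [W1 c1 <-]] /asboolP[f2 [W2 c2 <-]]];
    apply/asboolP.
    by exists 0; split=> //; exact: covered0.
  by exists (a *: f1 + f2); split=> //; [apply: Wlin | apply: covered_comb].
- move=> h v /asboolP[f' [W' c' <-]]; apply/asboolP.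
  exists (ind_act (val h ^ g) f'); split; first exact: (actW _ W').
    by apply: covered_act_normal; rewrite ?nS ?subgroup_valP.
  by rewrite /= /conjg mulVKg ind_equivariant.
- move=> /(_ (f g)); rewrite [RHS]inE (negPf fg) => /negP[]; apply/asboolP.
  by exists f.
- by move=> ET v; have /asboolP : v \in E by rewrite ET.
Qed.

Lemma single_coset_full g f :
  f \in W -> covered [:: g] f -> f != 0 -> W =i predT.
Proof.
move=> fW cf f0; have fg : f g != 0.
  by apply: contra_neq f0 => f0; apply: covered_nil; apply: covered_behead f0.
have onto := eval_onto fW cf fg; have [W0 Wlin] := submodW.
move=> F; rewrite [RHS]inE; have [s] := coveredP F.
elim: s F => [|k s IHs] F cF; first by rewrite (covered_nil cF).
have [f' [W' c' e']] := onto (F k).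
(* This translate is supported on the coset of [k] and agrees with [F] at [k]; subtracting it
   removes [k] from the cover. *)
pose f'' := ind_act (k^-1 * g) f'.
have W'' : f'' \in W by exact: (actW _ W').
rewrite -(subrK f'' F) -[F - _]scale1r Wlin //; apply: IHs.
apply: (@covered_behead _ k); last first.
  by rewrite -[LHS]/(F k - f' (k * (k^-1 * g))%g) mulVKg e' subrr.
rewrite addrC -scaleN1r; apply: covered_comb cF => x.
move=> /(covered_act c')[y /=]; rewrite inE => /eqP-> kx.
by exists k; rewrite ?mem_head //; move: kx; rewrite invgM invgK mulVKg.
Qed.

(** The bound ranges over all of [W], so it also applies to functions other than the one that
    attains it. *)
Definition minimal_cover (s : seq G) : Prop :=
  forall s' f, f \in W -> covered s' f -> f != 0 -> (size s <= size s')%N.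

Lemma minimal_cover_exists f : f \in W -> f != 0 ->
  exists s f', [/\ minimal_cover s, f' \in W, covered s f' & f' != 0].
Proof.
move=> fW f0; have [s cf] := coveredP f.
pose P n :=
  `[< exists s f', [/\ size s = n, f' \in W, covered s f' & f' != 0] >].
have exP : exists n, P n by exists (size s); apply/asboolP; exists s, f.
case: (ex_minnP exP) => n /asboolP[s' [f' [sz W' c' n0]]] min.
exists s', f'; split=> // s2 f2 W2 c2 n2.
by rewrite sz; apply: min; apply/asboolP; exists s2, f2.
Qed.

(** A nonzero [f] vanishing at [g] would be covered without [g], by a shorter list. *)
Lemma minimal_cover_eval_inj s g f : minimal_cover s -> g \in s ->
  f \in W -> covered s f -> f g = 0 -> f = 0.
Proof.
move=> min gs fW cf fg; apply/eqP; apply: contraT => f0.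
have /covered_behead/(_ fg) c : covered (g :: rem g s) f.
  exact: covered_mem (perm_mem (perm_to_rem gs)) cf.
have := min _ _ fW c f0; rewrite size_rem //.
by case: s gs {min cf c} => //= y s _; rewrite ltnn.
Qed.

Lemma minimal_cover_uniq g0 g1 s f : minimal_cover [:: g0, g1 & s] ->
  f \in W -> covered [:: g0, g1 & s] f -> f != 0 -> ~ coset g0 g1.
Proof.
move=> min fW cf f0 g01.
suff /(min _ _ fW)/(_ f0) : covered (g0 :: s) f by rewrite /= ltnn.
move=> x /cf[g]; rewrite !inE => /or3P[/eqP->|/eqP-> gx|gs].
- by exists g0; rewrite ?mem_head.
- by exists g0; [rewrite mem_head | apply: right_coset_trans gx].
- by exists g; rewrite // inE gs orbT.
Qed.

(** On the functions of [W] with this cover, [theta] is evaluation at [g1] after the inverse of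
    evaluation at [g0]. *)
Lemma minimal_cover_translation g0 g1 s f : minimal_cover [:: g0, g1 & s] ->
  f \in W -> covered [:: g0, g1 & s] f -> f != 0 ->
  exists theta : V -> V,
    [/\ linear theta, exists v, theta v != 0 &
        forall h k : H, val h = (val k ^ (g1 * g0^-1))%g ->
          forall v, theta (rho h v) = rho k (theta v)].
Proof.
set c := [:: g0, g1 & s] => min fW cf f0.
have [W0 Wlin] := submodW.
have g0c : g0 \in c by rewrite mem_head.
have inj f' : f' \in W -> covered c f' -> f' g0 = 0 -> f' = 0.
  exact: minimal_cover_eval_inj.
have fg0 : f g0 != 0 by apply: contra_neq f0; exact: inj.
(* [L] is a chosen section of evaluation at [g0]; injectivity makes it a two-sided inverse, hence
   linear. *)
have [L Lp] := choice (eval_onto fW cf fg0).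
have LE f' : f' \in W -> covered c f' -> L (f' g0) = f'.
  move=> W' c'; have [WL cL eL] := Lp (f' g0).
  apply/eqP; rewrite -subr_eq0; apply/eqP; rewrite addrC -scaleN1r.
  apply: inj; [exact: Wlin | exact: covered_comb |].
  by rewrite -[LHS]/(-1 *: f' g0 + L (f' g0) g0) eL scaleN1r addNr.
exists (fun v => L v g1); split=> [a u v||h k hk v].
- have [Wu cu eu] := Lp u; have [Wv cv ev] := Lp v.
  have := LE _ (Wlin a _ _ Wu Wv) (covered_comb (a := a) cu cv).
  by rewrite -[(_ + _ : ind rho) g0]/(a *: L u g0 + L v g0) eu ev => ->.
- exists (f g0); rewrite LE //; apply: contra_neq f0.
  by apply: minimal_cover_eval_inj min _ fW cf; rewrite !inE eqxx orbT.
- have [Wv cv ev] := Lp v.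
  (* Translation by [h ^ g0 = k ^ g1] acts as [rho h] on values at [g0] and as [rho k] on values at
     [g1]. *)
  have := LE (ind_act (val h ^ g0) (L v)) (actW _ Wv).
  rewrite /= {1}/conjg mulVKg ind_equivariant ev => -> /=; last first.
    by apply: covered_act_normal; rewrite ?nS ?subgroup_valP.
  by rewrite hk -conjgM mulgVK /conjg mulVKg ind_equivariant.
Qed.

End Subrepresentation.

End Induced.

(* ind_endo rho is a homomorphism of rings and of K-vector spaces (instances
   in Defs), so it is an isomorphism exactly when it is bijective. *)
Theorem proposition3p6 (K : fieldType) (G : groupType) (S : {pred G})
    (H : subGroupType S) (V : lmodType K) (rho : representation H V)
    (normalH : normal_subgroup S)
    (irr_rho : irreducible rho)
    (iso_end : bijective (ind_endo rho)) :
  irreducible (ind_rep rho).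
Proof.
split=> [|W submodW actW].
  have [[v v0] _] := irr_rho; exists (delta rho v).
  by apply: contra_neq v0 => d0; rewrite -(delta1 rho v) d0.
have [[f [fW f0]]|noW] := pselect (exists f, f \in W /\ f != 0); last first.
  left=> f; rewrite [RHS]inE; have [->|f0] := eqVneq f 0.
    by have [->] := submodW.
  by apply/negP => fW; apply: noW; exists f.
right; have [s [f' [min W' c' n0]]] := minimal_cover_exists fW f0.
case: s min c' => [|g0 [|g1 s]] min c'.
- by rewrite (covered_nil c') eqxx in n0.
- exact: single_coset_full W' c' n0.
have [theta [lin [v /eqP tv0] comm]] :=
  minimal_cover_translation normalH irr_rho submodW actW min W' c' n0.
have [inv _ invK] := iso_end.
pose T := Endo (translation_intertwining lin comm normalH).
have tS : (g1 * g0^-1)%g \notin S.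
  apply/negP => /(subgroup_val_ex (H := H))[h hE].
  apply: (minimal_cover_uniq min W' c' n0).
  by exists h; rewrite // hE mulgVK.
(* Surjectivity makes [T] the endomorphism induced by [inv T], which forces [theta] to vanish. *)
case: tv0; apply: (translation_induced_eq0 tS (psi := inv T)) => F.
by rewrite invK.
Qed.
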